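(* Let $p \geq 5$ be a prime number and let $P = C_p \wr C_p$ be the wreath product of the cyclic group $C_p$ of order $p$ with $C_p$. Then there exist faithful irreducible complex characters $\varphi, \psi \in \operatorname{Irr}(P)$ such that the product $\varphi\psi$ has exactly $p-1$ distinct irreducible constituents.
   Context: $C_p$ denotes the cyclic group of order $p$. The wreath product $C_p \wr C_p$ is the regular one: the semidirect product $A \rtimes C_p$, where the base group $A = (C_p)^p$ is elementary abelian of order $p^p$ and the top group $C_p$ acts on $A$ by cyclically permuting the $p$ coordinates. $\operatorname{Irr}(P)$ denotes the set of irreducible complex characters of the finite group $P$. A character is faithful if its kernel is trivial. The product $\varphi\psi$ is the pointwise product, i.e. the character $g \mapsto \varphi(g)\psi(g)$ (the character of the tensor product of the corresponding representations). The distinct irreducible constituents of a character $\chi$ of $P$ are the $\theta \in \operatorname{Irr}(P)$ with $\langle \chi, \theta\rangle \neq 0$; they are counted without multiplicity. *)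

(* Defs.v *)
From HB Require Import structures.
From mathcomp Require Import all_boot all_fingroup all_algebra.
From mathcomp Require Import all_solvable all_field all_character.

Set Implicit Arguments.
Unset Strict Implicit.
Unset Printing Implicit Defensive.

Import GroupScope.

Section RegularWreath.

Variables gT hT : finGroupType.

(* The base group: the direct product of copies of gT indexed by hT, with the
   library's componentwise group structure. *)
Definition wrbase : finGroupType := {dffun forall _ : hT, gT}.

(* hT permutes the coordinates regularly.  MathComp actions are right actions,
   whence the left translation of the index. *)
Definition wrshift (f : wrbase) (b : hT) : wrbase := [ffun x => f (b * x)].

Lemma wrshift_is_action : is_action [set: hT] wrshift.
Proof.
split=> [b f g eq_fg | f b c _ _].
  apply/ffunP=> x; move/ffunP/(_ (b^-1 * x)): eq_fg.
  by rewrite !ffunE mulKVg.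
by apply/ffunP=> x; rewrite !ffunE mulgA.
Qed.

Definition wraction := Action wrshift_is_action.

Lemma wrshift_is_groupAction : is_groupAction [set: wrbase] wraction.
Proof.
move=> b Db; rewrite /= inE; apply/andP; split.
  by apply/subsetP=> f _; rewrite inE.
apply/morphicP=> f g _ _; rewrite !actpermE /=.
by apply/ffunP=> x; rewrite !ffunE.
Qed.

Definition wrgact := GroupAction wrshift_is_groupAction.

(* gT wr hT *)
Definition rwreath : finGroupType := sdprod_groupType wrgact.

End RegularWreath.

(* Main.v *)
Require Import Defs.
From mathcomp Require Import all_boot all_fingroup all_algebra.
From mathcomp Require Import all_solvable all_field all_character.

(** Linear characters of the base group A = (Z/p)^p are the maps
    L_a : f |-> w^(sum_x a_x f_x) with a in (Z/p)^p, and Ind L_a is irreducible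
    as soon as the cyclic shifts of a are distinct.  By Mackey, Ind L_a * Ind L_b
    is the sum of the Ind L_(a + b') over the p shifts b' of b.  With
    a = -(d_0 + d_1) and b = d_0 (indicator functions), the weights are
    d_j - d_0 - d_1: for j = 0, 1 these are -d_1 and -d_0, which are shifts of
    one another, while for j <> 0, 1 the position of the value 1 and of the two
    values -1 show that there is no further coincidence.  Both Ind L_a and
    Ind L_b are faithful because the shifts of a (p being odd) and of b
    separate the points of A. *)

Set Implicit Arguments.
Unset Strict Implicit.
Unset Printing Implicit Defensive.

Import GroupScope GRing.Theory Num.Theory.

(** * Characters induced from linear characters of the base group *)

Section BaseCharacters.

Local Open Scope ring_scope.

Variables (m : nat) (hT : finGroupType) (w : algC).
Hypotheses (m_gt1 : (1 < m)%N) (prim_w : m.-primitive_root w).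

Local Notation base := (wrbase 'Z_m hT).
Local Notation to := (wrgact 'Z_m hT).
Local Notation W := (rwreath 'Z_m hT).
Local Notation P := [set: W]%G.
Local Notation N := (sdpair1 to @* [set: base])%G.
Local Notation inN := (sdpair1 to).
Implicit Types a b c f g : base.

(* [base] is written multiplicatively as a group, so [a * b] below is the sum
   of the weights [a] and [b]. *)
Definition wrdot a f : 'Z_m := \sum_x a x * f x.

Lemma wrdotC a f : wrdot a f = wrdot f a.
Proof. by apply: eq_bigr => x _; rewrite mulrC. Qed.

Lemma wrdotDr a f g : wrdot a (f * g)%g = wrdot a f + wrdot a g.
Proof.
by rewrite -big_split; apply: eq_bigr => x _; rewrite /= ffunE mulrDr.
Qed.

Lemma wrdot_shift a f h : wrdot a (wrshift f h) = wrdot (wrshift a h^-1%g) f.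
Proof.
rewrite /wrdot (reindex_inj (mulgI h^-1%g)); apply: eq_bigr => x _.
by rewrite !ffunE mulKVg.
Qed.

Definition wrdelta (j : hT) : base := [ffun x => (x == j)%:R].

Lemma wrdot_delta a j : wrdot a (wrdelta j) = a j.
Proof.
rewrite /wrdot (bigD1 j) //= ffunE eqxx mulr1 big1 ?addr0 // => x /negPf nxj.
by rewrite ffunE nxj mulr0.
Qed.

Lemma exprZpD (x y : 'Z_m) : w ^+ (x + y)%R = w ^+ x * w ^+ y.
Proof.
(* The modulus of ['Z_m] is m only because m > 1; the reduction is then invisible to w. *)
have -> : (x + y)%R = ((x + y) %% m)%N :> nat.
  by rewrite /=; congr modn; rewrite Zp_cast.
by rewrite -exprD (prim_expr_mod prim_w).
Qed.

Lemma exprZp_inj : injective (fun x : 'Z_m => w ^+ x).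
Proof.
have lt_m (z : 'Z_m) : (z < m)%N by rewrite (leq_trans (ltn_ord z)) ?Zp_cast.
move=> x y /= /eqP; rewrite (eq_prim_root_expr prim_w) !modn_small //.
by move/eqP/val_inj.
Qed.

(** Left inverse of [inN], defined on all of W so that characters of N are given by a formula; it is
    used as a morphism only on N. *)
Definition sdsnd (u : W) : base := (u : sdprod_by to).2.

Lemma inN_snd f : sdsnd (inN f) = f.
Proof. by rewrite /sdsnd /sdpair1 val_insubd inE !inE. Qed.

Lemma wrchar_mx_repr a :
  mx_repr N (fun u => (w ^+ wrdot a (sdsnd u))%:M : 'M[algC]_1).
Proof.
split=> [|_ _ /morphimP[f _ _ ->] /morphimP[g _ _ ->]].
  rewrite -(morph1 [morphism of inN]) inN_snd.
  suff ->: wrdot a 1%g = 0 by [].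
  by rewrite /wrdot big1 // => x _; rewrite ffunE mulr0.
by rewrite -morphM ?inE // !inN_snd wrdotDr exprZpD -scalar_mxM.
Qed.

Definition wrchar a : 'CF(N) := cfRepr (MxRepresentation (wrchar_mx_repr a)).

Lemma wrcharE a f : wrchar a (inN f) = w ^+ wrdot a f.
Proof.
by rewrite cfunE mem_morphim ?inE // mulr1n mxtrace_scalar inN_snd.
Qed.

Lemma wrchar_lin a : wrchar a \is a linear_char.
Proof. by rewrite qualifE /= cfRepr_char cfRepr1 eqxx. Qed.

Lemma eq_wrchar (phi psi : 'CF(N)) :
  (forall f, phi (inN f) = psi (inN f)) -> phi = psi.
Proof. by move=> eqf; apply/cfun_inP=> _ /morphimP[f _ _ ->]; apply: eqf. Qed.

Lemma wrcharM a b : wrchar (a * b)%g = wrchar a * wrchar b.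
Proof.
apply: eq_wrchar => f.
by rewrite wrcharE cfunE !wrcharE wrdotC wrdotDr exprZpD !(wrdotC f).
Qed.

Lemma wrchar_inj : injective wrchar.
Proof.
move=> a b eqab; apply/ffunP=> x; apply: exprZp_inj => /=.
by rewrite -!wrdot_delta -!wrcharE eqab.
Qed.

Lemma cfdot_wrchar a b : '[wrchar a, wrchar b] = (a == b)%:R.
Proof.
have /irrP[i Ei] := lin_char_irr (wrchar_lin a).
have /irrP[j Ej] := lin_char_irr (wrchar_lin b).
by rewrite -(inj_eq wrchar_inj) Ei Ej cfdot_irr (inj_eq irr_inj).
Qed.

Definition wrInd a : 'CF(P) := 'Ind[P] (wrchar a).

Lemma wrInd_char a : wrInd a \is a character.
Proof. by rewrite cfInd_char ?lin_charW ?wrchar_lin. Qed.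

(** On N, induction sums the conjugates under the complement. [wrdot_shift] moves each shift from
    the argument to the weight; reindexing by inverses absorbs the sign. *)
Lemma Res_wrInd a : 'Res[N] (wrInd a) = \sum_h wrchar (wrshift a h).
Proof.
apply: eq_wrchar => f.
rewrite cfResE ?subsetT ?mem_morphim ?inE //.
rewrite (cfIndEsdprod _ _ (sdprod_sdpair to)) /= morphimEdom.
rewrite big_imset /=; last by move=> x y *; apply: (injmP (injm_sdpair2 to)).
rewrite sum_cfunE (reindex_inj invg_inj) /=.
apply: eq_big => [h|h _]; first by rewrite inE.
by rewrite -sdpair_act ?inE // !wrcharE wrdot_shift invgK.
Qed.

Lemma cfdot_wrInd a b :
  '[wrInd a, wrInd b] = \sum_h (a == wrshift b h)%:R.
Proof.
rewrite -Frobenius_reciprocity Res_wrInd cfdot_sumr.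
by apply: eq_bigr => h _; rewrite cfdot_wrchar.
Qed.

Lemma wrInd_irr a : (forall h, wrshift a h = a -> h = 1%g) -> wrInd a \in irr P.
Proof.
move=> free_a; rewrite irrEchar wrInd_char cfdot_wrInd.
rewrite (bigD1 1%g) //= [wrshift _ _](act1 (wraction _ _)) eqxx big1 ?addr0 // => h.
by apply: contraNeq; rewrite pnatr_eq0 eqb0 negbK => /eqP/esym/free_a->.
Qed.

(** The inner product of the two characters is 1, so some term of [cfdot_wrInd] is nonzero. *)
Lemma wrInd_eqP a b : (forall h, wrshift a h = a -> h = 1%g) ->
  wrInd a = wrInd b -> exists h, wrshift b h = a.
Proof.
move=> /wrInd_irr; rewrite irrEchar => /andP[_ /eqP Da] eqab.
case: (pickP (fun h => wrshift b h == a)) => [h /eqP|nab]; first by exists h.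
have := Da; rewrite {2}eqab cfdot_wrInd big1 => [/eqP|h _].
  by rewrite eq_sym oner_eq0.
by rewrite eq_sym nab.
Qed.

(** Both sides vanish off the normal subgroup N, and on N they sum over the same orbit of
    weights. *)
Lemma wrInd_shift a h : wrInd (wrshift a h) = wrInd a.
Proof.
have [nsN _ _ _ _] := sdprod_context (sdprod_sdpair to).
apply/cfun_inP => u _; have [Nu | nNu] := boolP (u \in N); last first.
  by rewrite !(cfun_on0 (cfInd_normal _ nsN)).
rewrite -!(cfResE _ (subsetT N) Nu) !Res_wrInd; congr (fun_of_cfun _ _).
rewrite [RHS](reindex_inj (mulgI h)); apply: eq_bigr => k _.
by congr wrchar; apply/ffunP=> x; rewrite !ffunE mulgA.
Qed.

Lemma wrIndM a b : wrInd a * wrInd b = \sum_h wrInd (a * wrshift b h)%g.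
Proof.
rewrite -cfIndM ?subsetT // Res_wrInd mulr_sumr linear_sum.
by apply: eq_bigr => h _; rewrite -wrcharM.
Qed.

(** The kernel of an induced character is the normal core of the kernel of the original one, and a
    core containing [inN f] contains all shifts of f. *)
Lemma wrInd_faithful a :
  (forall f, (forall h, wrdot a (wrshift f h) = 0) -> f = 1%g) ->
  cfaithful (wrInd a).
Proof.
move=> nondeg_a; rewrite /cfaithful cfker_Ind ?subsetT ?lin_charW ?wrchar_lin //.
  set K := gcore _ _; have sKker: K \subset cfker (wrchar a) by apply: gcore_sub.
  apply/subsetP=> u Ku; have Nu := subsetP (cfker_sub _) _ (subsetP sKker _ Ku).
  case/morphimP: Nu Ku => f _ _ -> Kf; rewrite (nondeg_a f) ?morph1 ?inE // => h.
  have Kfh: inN (wrshift f h) \in cfker (wrchar a).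
    rewrite (subsetP sKker) // [inN _](@sdpair_act _ _ _ _ to) ?inE //.
    by rewrite memJ_norm // (subsetP (gcore_norm _ _)) ?inE.
  apply: exprZp_inj; rewrite /= -wrcharE (cfker1 Kfh) lin_char1 ?wrchar_lin //.
by have /irrP[i ->] := lin_char_irr (wrchar_lin a); apply: irr_neq0.
Qed.

End BaseCharacters.

(** Multiplicities are natural numbers, so no cancellation occurs and the constituents are exactly
    the values of F. *)
Lemma card_constt_sum_irr (gT : finGroupType) (G : {group gT}) (I : finType)
    (F : I -> 'CF(G)) :
  (forall i, F i \in irr G) ->
  #|irr_constt (\sum_i F i)%R| = #|[set cfIirr (F i) | i : I]|.
Proof.
move=> irrF; apply: eq_card => j; rewrite irr_consttE cfdot_suml.
under eq_bigr => i _ do rewrite -(cfIirrE (irrF i)) cfdot_irr.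
rewrite -natr_sum pnatr_eq0 sum_nat_eq0.
apply/forallPn/imsetP => [[i] | [i _ ->]]; last by exists i; rewrite eqxx.
by rewrite /= eqb0 negbK => /eqP <-; exists i.
Qed.

(** * The weights of the product and their coincidences under shifts *)

Section TwoFaithfulCharacters.

Local Open Scope ring_scope.

Variable p : nat.
Hypothesis p_gt2 : (2 < p)%N.
Local Notation base := (wrbase 'Z_p 'Z_p).

Let Zp_2_neq0 : (2%:R : 'Z_p) != 0.
Proof.
apply/eqP => /(congr1 (@nat_of_ord _)).
by rewrite val_Zp_nat ?(ltnW p_gt2) // modn_small.
Qed.

Let Zp_1_neqN1 : (1 : 'Z_p) != - 1.
Proof. by rewrite -addr_eq0 Zp_2_neq0. Qed.

Definition negdelta01 : base := [ffun x => - ((x == 0)%:R + (x == 1)%:R)].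

Definition deltasum (j : 'Z_p) : base :=
  [ffun x => (x == j)%:R - ((x == 0)%:R + (x == 1)%:R)].

(** The sign of j comes from left translation: j + x = 0 means x = -j. *)
Lemma deltasumE j :
  (negdelta01 * wrshift (wrdelta p (0 : 'Z_p)) j)%g = deltasum (- j).
Proof.
apply/ffunP=> x; rewrite !ffunE [LHS]addrC; congr (_%:R - _).
by rewrite [(j * x)%g]addrC addr_eq0.
Qed.

Let Zp_eqF : ((0 : 'Z_p) == 1 = false) * ((1 : 'Z_p) == 0 = false)
  * ((-1 : 'Z_p) == 1 = false) * ((1 : 'Z_p) == -1 = false)
  * ((-1 : 'Z_p) == 0 = false) * ((0 : 'Z_p) == -1 = false).
Proof.
by rewrite ![0 == _]eq_sym [-1 == 1]eq_sym oppr_eq0 oner_eq0 (negPf Zp_1_neqN1).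
Qed.

Lemma deltasum_eq1 j x :
  (deltasum j x == 1) = [&& j != 0, j != 1 & x == j].
Proof.
rewrite ffunE; have [->|_] := eqVneq x j; last first.
  have [->|_] := eqVneq x 0; have [_|_] := eqVneq x 1;
  by rewrite !(andbF, add0r, addr0, sub0r, oppr0, Zp_eqF).
have [->|_] := eqVneq j 0; have [_|_] := eqVneq j 1;
by rewrite ?(addr0, add0r, subrr, subr0, Zp_eqF, eqxx).
Qed.

Lemma deltasum_eqN1 j x :
  (deltasum j x == -1) = ((x == 0) || (x == 1)) && (x != j).
Proof.
rewrite ffunE; have [->|_] := eqVneq x j; last first.
  have [->|_] := eqVneq x 0; have [_|_] := eqVneq x 1;
  by rewrite ?(andbT, add0r, addr0, sub0r, oppr0, Zp_eqF, eqxx).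
have [->|_] := eqVneq j 0; have [_|_] := eqVneq j 1;
by rewrite ?(andbF, addr0, add0r, subrr, subr0, Zp_eqF).
Qed.

(** Translation by k must match the places of the value 1, and those of the value -1. *)
Lemma deltasum_shift j j' k : wrshift (deltasum j) k = deltasum j' ->
  k = 0 /\ j = j' \/ [/\ j != j', j \in [:: 0; 1] & j' \in [:: 0; 1]].
Proof.
move=> eq_jj'; have eqv x : deltasum j (k + x) = deltasum j' x.
  by rewrite -eq_jj' [RHS]ffunE.
have to1 x : [&& j != 0, j != 1 & k + x == j] = [&& j' != 0, j' != 1 & x == j'].
  by rewrite -!deltasum_eq1 eqv.
have toN1 x : ((k + x == 0) || (k + x == 1)) && (k + x != j)
            = ((x == 0) || (x == 1)) && (x != j').
  by rewrite -!deltasum_eqN1 eqv.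
(* For j in {0, 1} the value 1 is not taken, which forces j' into {0, 1}; if j' = j, the only place
   of -1 is fixed and k = 0. *)
rewrite !inE; have [j01|nj01] := boolP ((j == 0) || (j == 1)).
  have j'01 : (j' == 0) || (j' == 1).
    apply: contraT; rewrite negb_or => /andP[nj'0 nj'1].
    have := to1 j'; rewrite nj'0 nj'1 eqxx /=.
    by case/orP: j01 => ->; rewrite ?andbF.
  have [eqj|_] := eqVneq j j'; last by right.
  left; split=> //; case/orP: j01 => /eqP j_eq; subst j'; subst j.
    have := toN1 1; rewrite eqxx Zp_eqF => /andP[] /orP[-> //|].
    by rewrite -subr_eq0 addrK => /eqP.
  have := toN1 0; rewrite eqxx addr0 eq_sym Zp_eqF.
  by move=> /andP[] /orP[/eqP //|->].
move: nj01; rewrite negb_or => /andP[nj0 nj1].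
(* Now 1 is taken only at j, so j' = j - k lies outside {0, 1}. Then -1 is taken at both 0 and 1,
   whence k is 0 or 1, and k = 1 would send 1 to 2. *)
have := to1 (j - k); rewrite addrC subrK nj0 nj1 eqxx.
move=> /esym/and3P[nj'0 nj'1 /eqP j'E].
have := toN1 0; rewrite eqxx addr0 [0 == j']eq_sym nj'0 => /andP[k01 _].
suff k0 : k = 0 by left; rewrite -j'E k0 subr0.
case/orP: k01 => /eqP // k1; have := toN1 1.
rewrite k1 eqxx orbT [1 == j']eq_sym nj'1 => /andP[/orP[]].
  by rewrite (negPf Zp_2_neq0).
by rewrite -subr_eq0 addrK Zp_eqF.
Qed.

Lemma wrdot_negdelta01 (f : base) h :
  wrdot negdelta01 (wrshift f h) = - (f h + f (h + 1)).
Proof.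
rewrite /wrdot.
under eq_bigr => x _ do rewrite !ffunE mulNr mulrDl !mulr_natl.
rewrite sumrN big_split /=; congr (- (_ + _)).
  rewrite (bigD1 0) //= [(h * 0)%g]addr0 big1 ?addr0 // => x /negPf-> //.
rewrite (bigD1 1) //= big1 ?addr0 // => x /negPf-> //.
Qed.

(** The support {0, 1} is stable under translation by k, and 2 lies outside it. *)
Lemma negdelta01_free k : wrshift negdelta01 k = negdelta01 -> k = 0.
Proof.
move=> eqk; have nz x : (negdelta01 x == 0) = ~~ ((x == 0) || (x == 1)).
  rewrite ffunE oppr_eq0; have [->|_] := eqVneq x 0.
    by rewrite !(Zp_eqF, addr0).
  by have [_|_] := eqVneq x 1; rewrite add0r ?Zp_eqF ?eqxx.
have shift_nz x :
    ((k + x == 0) || (k + x == 1)) = ((x == 0) || (x == 1)).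
  by apply: negb_inj; rewrite -!nz -[in RHS]eqk [in RHS]ffunE.
have := shift_nz 0; rewrite eqxx addr0 => /orP[/eqP //|/eqP k1].
have := shift_nz 1; rewrite k1 eqxx orbT (negPf Zp_2_neq0) /=.
by rewrite -subr_eq0 addrK Zp_eqF.
Qed.

Lemma delta0_free k :
  wrshift (wrdelta p (0 : 'Z_p)) k = wrdelta p (0 : 'Z_p) -> k = 0.
Proof.
move/ffunP/(_ 0); rewrite !ffunE [(k * 0)%g]addr0 eqxx.
by case: eqP => // _ /eqP; rewrite Zp_eqF.
Qed.

Lemma deltasum_free j k : wrshift (deltasum j) k = deltasum j -> k = 0.
Proof. by case/deltasum_shift=> [[] //|[]]; rewrite eqxx. Qed.

(** * Faithfulness and the count of constituents *)

Hypothesis p_odd : odd p.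
Variable w : algC.
Hypothesis prim_w : p.-primitive_root w.

Let p_gt1 : (1 < p)%N := ltnW p_gt2.

Lemma wrInd_delta0_faithful :
  cfaithful (wrInd p_gt1 prim_w (wrdelta p (0 : 'Z_p))).
Proof.
apply: wrInd_faithful => f f0; apply/ffunP=> h; rewrite ffunE -[RHS](f0 h).
by rewrite wrdotC wrdot_delta ffunE [(h * 0)%g]addr0.
Qed.

(** A function f killed by all shifts changes sign at each step x -> x + 1. Going once around the
    cycle takes an odd number p of steps, so 2 f = 0. *)
Lemma wrInd_negdelta01_faithful : cfaithful (wrInd p_gt1 prim_w negdelta01).
Proof.
apply: wrInd_faithful => f f0; apply/ffunP=> h; rewrite ffunE.
have fS x : f (x + 1) = - f x.
  apply/eqP; rewrite -addr_eq0 addrC -oppr_eq0; apply/eqP.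
  by rewrite -wrdot_negdelta01.
have fD n : f (h + n%:R) = (-1) ^+ n * f h.
  elim: n => [|n IHn]; first by rewrite addr0 mul1r.
  by rewrite -natr1 addrA fS IHn exprS -mulrA mulN1r.
have p0 : (p%:R : 'Z_p) = 0 by apply: pchar_Zp.
have f2 : f h *+ 2 = 0.
  have /eqP := fD p; rewrite p0 addr0 -signr_odd p_odd mulN1r.
  by rewrite -addr_eq0 -mulr2n => /eqP.
have even_pS : ~~ odd p.+1 by rewrite /= p_odd.
(* Here 1 = p + 1 modulo p is twice an integer, so f h is a multiple of 2 f h. *)
rewrite -[f h]mulr1 -[1]addr0 -p0 nat1r -(even_halfK even_pS) -mul2n.
by rewrite mulr_natr mulrnA f2 mul0rn.
Qed.

Lemma card_constt_negdelta01_delta0 :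
  #|irr_constt (wrInd p_gt1 prim_w negdelta01
                * wrInd p_gt1 prim_w (wrdelta p (0 : 'Z_p)))| = (p - 1)%N.
Proof.
have irr_sum j : wrInd p_gt1 prim_w (deltasum j) \in irr _.
  by apply: wrInd_irr => k; apply: deltasum_free.
rewrite wrIndM (reindex_inj (@oppr_inj _)) /=.
under eq_bigr => j _ do rewrite deltasumE opprK.
rewrite card_constt_sum_irr //.
set F := fun j => _.
have F01 : F 0 = F 1.
  rewrite /F -(wrInd_shift p_gt1 prim_w (deltasum 0) 1%R); congr (cfIirr (wrInd _ _ _)).
  apply/ffunP=> x; rewrite !ffunE [((1%R : 'Z_p) * x)%g]addrC.
  rewrite -[x + 1 == 1]subr_eq0 addrK !opprD !addrA subrr sub0r.
  by rewrite addrAC subrr sub0r.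
(* The index 0 duplicates 1 and is dropped; on the other p - 1 indices F is injective, since the
   exceptional case of [deltasum_shift] would need j = j' = 1. *)
have -> : [set F j | j : 'Z_p] = F @: [set~ 0].
  apply/setP=> i; apply/imsetP/imsetP=> [] [j nj ->]; last by exists j.
  have [->|nj0] := eqVneq j 0; last by exists j; rewrite ?inE.
  by exists 1; rewrite ?inE ?Zp_eqF.
rewrite card_in_imset; last first.
  move=> j j'; rewrite !inE => nj nj' /(congr1 (fun i => 'chi_i)).
  rewrite !(cfIirrE (irr_sum _)) => /wrInd_eqP [k|k].
    exact: deltasum_free.
  case/deltasum_shift => [[_ ->] //|[njj]].
  by rewrite !inE (negPf nj) (negPf nj') => /eqP-> /eqP->.
by rewrite cardsC1 card_ord Zp_cast // subn1.
Qed.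

End TwoFaithfulCharacters.

Theorem mainTheorem1 (p : nat) (p_prime : prime p) (p_ge5 : 5 <= p) :
  let P := [set: rwreath 'Z_p 'Z_p]%G in
  exists phi psi : 'CF(P),
    [/\ phi \in irr P, psi \in irr P, cfaithful phi, cfaithful psi
      & #|irr_constt (phi * psi)%R| = p - 1].
Proof.
move=> P; have p_gt2: 2 < p by apply: leq_trans p_ge5.
have p_odd: odd p by case: (even_prime p_prime) p_gt2 => // ->.
have [w prim_w] := C_prim_root_exists (prime_gt0 p_prime).
exists (wrInd (ltnW p_gt2) prim_w (negdelta01 p)).
exists (wrInd (ltnW p_gt2) prim_w (wrdelta p (0%R : 'Z_p))); split.
- by apply: wrInd_irr; apply: negdelta01_free.
- by apply: wrInd_irr; apply: delta0_free.
- exact: wrInd_negdelta01_faithful.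
- exact: wrInd_delta0_faithful.
- exact: card_constt_negdelta01_delta0.
Qed.
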